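(* For all integers $\Delta,k\geq 1$, there exists $D=D(\Delta,k)$ such that the following holds. Let $H$ be an ordered graph with maximum degree $\Delta(H)\leq\Delta$ and interval chromatic number $\chi_<(H)\leq k$. Then there is a $D$-degenerate (finite, unordered) graph $G$ such that, for every linear ordering of $V(G)$, the resulting ordered graph contains a copy of $H$.
   Context: All graphs are finite and simple. An ordered graph is a graph equipped with a linear order on its vertex set. A copy of an ordered graph $H$ in an ordered graph $G'$ is a (not necessarily induced) subgraph of $G'$ isomorphic to $H$ via an order-preserving isomorphism. The interval chromatic number $\chi_<(H)$ is the minimum number of intervals (sets of consecutive vertices in the vertex order), each an independent set, into which $V(H)$ can be partitioned. A graph is $D$-degenerate if every nonempty subgraph of it has a vertex of degree at most $D$. *)

(* Defs.v *)
From mathcomp Require Import all_boot.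

Set Implicit Arguments.
Unset Strict Implicit.
Unset Printing Implicit Defensive.

Record sgraph := SGraph {
  vertex :> finType;
  adj : rel vertex;
  adj_sym : symmetric adj;
  adj_irr : irreflexive adj }.

Definition degree (G : sgraph) (x : G) : nat := #|[set y | adj x y]|.

Definition max_degree (G : sgraph) : nat := \max_(x : G) degree x.

(* The subgraph with vertex set S and edge relation f, not necessarily
   induced: f may omit edges of G between vertices of S. *)
Definition is_subgraph (G : sgraph) (S : {set G}) (f : rel G) : Prop :=
  symmetric f /\ (forall x y, f x y -> [/\ x \in S, y \in S & adj x y]).

Definition degenerate (D : nat) (G : sgraph) : Prop :=
  forall (S : {set G}) (f : rel G), is_subgraph S f -> S != set0 ->
    exists2 x, x \in S & #|[set y | f x y]| <= D.

Definition linear_order (T : Type) (le : rel T) : Prop :=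
  [/\ reflexive le, antisymmetric le, transitive le & total le].

Record ordered_graph := OrderedGraph {
  ograph :> sgraph;
  ole : rel ograph;
  ole_linear : linear_order ole }.

Definition is_copy (H G : ordered_graph) (S : {set G}) (f : rel G) : Prop :=
  is_subgraph S f /\
  exists phi : H -> G,
    [/\ injective phi,
        phi @: [set: H] = S,
        forall x y, f (phi x) (phi y) = adj x y
      & forall x y, ole (phi x) (phi y) = ole x y].

Definition contains_copy (G H : ordered_graph) : Prop :=
  exists (S : {set G}) (f : rel G), is_copy H S f.

Definition independent (G : sgraph) (A : {set G}) : bool :=
  [forall x in A, forall y in A, ~~ adj x y].

Definition is_interval (H : ordered_graph) (A : {set H}) : bool :=
  [forall x in A, forall z in A, forall y, ole x y && ole y z ==> (y \in A)].

(* The blocks of a MathComp partition are nonempty, which does not affect the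
   minimum number of blocks. *)
Definition interval_colouring (H : ordered_graph) (P : {set {set H}}) : bool :=
  partition P [set: H] && [forall A in P, is_interval A && independent A].

Lemma interval_colouring_exists (H : ordered_graph) :
  exists n, [exists P : {set {set H}}, interval_colouring P && (#|P| == n)].
Proof.
pose P := preim_partition (@id H) [set: H].
exists #|P|; apply/existsP; exists P; rewrite eqxx andbT.
apply/andP; split; first exact: preim_partitionP.
apply/forall_inP => A /imsetP[a _ ->] {A}.
apply/andP; split.
- apply/forall_inP => x; rewrite !inE => /eqP <-.
  apply/forall_inP => z; rewrite !inE => /eqP <-.
  apply/forallP => y; apply/implyP => ay; rewrite !inE.
  by have [_ anti _ _] := ole_linear H; apply/eqP; apply: anti.
- apply/forall_inP => x; rewrite !inE => /eqP <-.
  by apply/forall_inP => z; rewrite !inE => /eqP <-; rewrite adj_irr.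
Qed.

Definition interval_chromatic_number (H : ordered_graph) : nat :=
  ex_minn (interval_colouring_exists H).

(* Main.v *)
Require Import Defs.
From mathcomp Require Import all_boot zify.

(** The graph [G] has the subsets of a large set [T] as its vertices, and two
    subsets are adjacent when one is properly contained in the other and the
    larger one has at most [m] elements.  A subset of largest size in a subgraph
    has at most [2 ^ m] neighbours there, so [G] is [2 ^ m]-degenerate however
    large [T] is, and [m] will depend only on [Delta] and [k].

    Fix an adversarial order on the subsets of [T].  A vertex [v] of [H] is sent
    to the union of a control set of size [h], specific to [v], and a set [O] of
    size [h] containing the images of those neighbours of [v] that were embedded
    before it; this makes adjacency automatic.  The difficulty is that the
    adversary can base the order on the content [O], which is dictated by the
    edges, instead of on the control.  Ramsey's theorem overcomes it
    ([dominant_half]): on a large subset of [T] the order of the [2h]-sets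
    is dominated either by their lower halves or by their upper halves, so it
    suffices to put the controls all below or all above the zone from which
    [O] is taken.  This gives many disjoint controls [0, ..., M - 1] such that
    sets with smaller control come first, whatever their contents
    ([controlled_exists]).  Iterating inside the zone gives [k] nested levels
    ([tower_exists]), one for each interval of [H]; since the images of all
    earlier neighbours must fit into [O], the size [h] is multiplied by
    [2 * Delta] from each level to the next.

    The levels still have to be placed in succession in the order.  Which level
    comes first cannot be prescribed, but it does not matter which level hosts
    which interval of [H]: one cuts the controls into [k] ranges and lets the
    [p]-th interval use the [p]-th range of the level, among those not yet used,
    that reaches the end of that range earliest ([greedy_order]).  Then
    [tower_embedding] chooses the contents level by level. *)

(** * Ramsey's theorem for subsequences *)

Definition homogeneous {T : eqType} (f : seq T -> bool) r W c :=
  forall s, subseq s W -> size s = r -> f s = c.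

Lemma homogeneous_sub {T : eqType} (f : seq T -> bool) r W W' c :
  subseq W' W -> homogeneous f r W c -> homogeneous f r W' c.
Proof. by move=> sub hom s ss; apply: hom; apply: subseq_trans sub. Qed.

Definition ramsey_at r := forall M, exists N,
  forall (T : eqType) (W : seq T) (f : seq T -> bool), N <= size W ->
  exists W' c, [/\ subseq W' W, size W' = M & homogeneous f r W' c].

(** The intermediate object of the classical induction on [r]: the colour of an
    [r.+1]-subsequence depends only on its first entry. *)
Fixpoint end_homogeneous {T : eqType} (f : seq T -> bool) r
    (xs : seq (T * bool)) : Prop :=
  if xs is (x, c) :: xs' then
    homogeneous (fun s => f (x :: s)) r (unzip1 xs') c /\
    end_homogeneous f r xs'
  else True.

Lemma end_homogeneous_exists r : ramsey_at r -> forall t, exists N,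
  forall (T : eqType) (W : seq T) (f : seq T -> bool), N <= size W ->
  exists xs, [/\ subseq (unzip1 xs) W, size xs = t & end_homogeneous f r xs].
Proof.
move=> ram; elim=> [|t [N0 IH]].
  by exists 0 => T W f _; exists [::]; rewrite sub0seq.
have [N1 ramN] := ram N0; exists N1.+1 => T [|x W] f //= ltW.
have [W' [c [subW szW hom]]] := ramN T W (fun s => f (x :: s)) ltW.
have [|xs [subxs szxs endxs]] := IH T W' f; first by rewrite szW.
exists ((x, c) :: xs); split=> /=; last 1 first.
- by split=> //; apply: homogeneous_sub hom.
- by rewrite eqxx; apply: subseq_trans subW.
- by rewrite szxs.
Qed.

Lemma end_homogeneous_colour {T : eqType} (f : seq T -> bool) r xs c :
  end_homogeneous f r xs ->
  homogeneous f r.+1 (unzip1 [seq p <- xs | p.2 == c]) c.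
Proof.
elim: xs => [_ [|y s] //|[x b] xs IH /= [homx endxs]].
move/IH: endxs => {}IH.
case: (eqVneq b c) => [eq_bc|_ //]; rewrite eq_bc in homx.
case=> [|y s] //=; have [->|_] := eqVneq y x; last exact: IH.
move=> sub [sz]; apply: homx => //; apply: subseq_trans sub _.
exact/map_subseq/filter_subseq.
Qed.

(** Among [M + M] end-homogeneous entries, [M] carry the same colour. *)
Lemma ramsey r : ramsey_at r.
Proof.
elim: r => [|r IH] M.
  exists M => T W f leW; exists (take M W), (f [::]).
  by rewrite take_subseq size_takel //; split=> // s _ /size0nil->.
have [N endN] := end_homogeneous_exists r IH (M + M).
exists N => T W f /endN-/(_ f)[xs [subxs szxs endxs]].
have [c leMc] : exists c, M <= size [seq p <- xs | p.2 == c].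
  have := count_predC (fun p : T * bool => p.2 == true) xs.
  rewrite szxs => cnt.
  have [le|lt] := leqP M (count (fun p => p.2 == true) xs).
    by exists true; rewrite size_filter.
  exists false; rewrite size_filter.
  have -> : count (fun p : T * bool => p.2 == false) xs
      = count (predC (fun p : T * bool => p.2 == true)) xs.
    by apply: eq_count => -[? []].
  by rewrite -(leq_add2l M) -cnt leq_add2r ltnW.
set W' := unzip1 [seq p <- xs | p.2 == c].
exists (take M W'), c; split.
- apply: subseq_trans subxs; apply: subseq_trans (take_subseq _ _) _.
  exact/map_subseq/filter_subseq.
- by rewrite size_takel // size_map.
- by apply: homogeneous_sub (take_subseq _ _) _; apply: end_homogeneous_colour.
Qed.

(** Homogeneity passes to subsequences, so several colourings, on subsequences of
    different sizes, can be treated one after the other. *)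
Lemma ramsey_many (rs : seq nat) M : exists N,
  forall (T : eqType) (W : seq T) (f : nat -> seq T -> bool), N <= size W ->
  exists W' c, [/\ subseq W' W, size W' = M &
    forall i, i < size rs -> homogeneous (f i) (nth 0 rs i) W' (c i)].
Proof.
elim: rs => [|r rs [N0 IH]].
  exists M => T W f leW; exists (take M W), xpredT.
  by rewrite take_subseq size_takel.
have [N ram] := ramsey r N0; exists N => T W f leW.
have [W1 [c1 [sub1 sz1 hom1]]] := ram T W (f 0) leW.
have [|W2 [c2 [sub2 sz2 hom2]]] := IH T W1 (fun i => f i.+1); first by rewrite sz1.
exists W2, (fun i => if i is j.+1 then c2 j else c1); split=> //.
  exact: subseq_trans sub1.
by case=> [_|i lti] /=; [apply: homogeneous_sub hom1 | apply: hom2].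
Qed.

(** * Orders on the concatenations of two blocks *)

Definition oriented {T : Type} (lt : rel T) (e : bool) : rel T :=
  fun x y => if e then lt x y else lt y x.

Lemma oriented_trans {T : Type} (lt : rel T) e :
  transitive lt -> transitive (oriented lt e).
Proof.
move=> tr y x z; rewrite /oriented; case: e; first exact: tr.
by move=> lt_yx lt_zy; apply: tr lt_zy lt_yx.
Qed.

Definition total_on_subseqs {T : eqType} (lt : rel (seq T)) W :=
  forall s t, subseq s W -> subseq t W -> s != t -> lt s t || lt t s.

Definition block {T : Type} h j (s : seq T) := take h (drop (j * h) s).

Lemma block0 {T : Type} h (L s : seq T) : size L = h -> block h 0 (L ++ s) = L.
Proof. by rewrite /block drop0 => <-; rewrite take_size_cat. Qed.

Lemma blockL {T : Type} h (L : seq T) : size L = h -> block h 0 L = L.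
Proof. by move=> sz; rewrite /block drop0 take_oversize ?sz. Qed.

Lemma blockS {T : Type} h j (L s : seq T) :
  size L = h -> block h j.+1 (L ++ s) = block h j s.
Proof.
by move=> sz; rewrite /block mulSn drop_cat sz ltnNge leq_addr /= addKn.
Qed.

Lemma size_block {T : Type} h M i (A : seq T) :
  size A = M * h -> i < M -> size (block h i A) = h.
Proof.
move=> szA lti; rewrite size_takel // size_drop szA -mulnBl leq_pmull //.
by rewrite subn_gt0.
Qed.

Lemma block_subseq {T : eqType} h i (A : seq T) : subseq (block h i A) A.
Proof. exact: subseq_trans (take_subseq _ _) (drop_subseq _ _). Qed.

Lemma block_cat_subseq {T : eqType} h i j (A : seq T) :
  i < j -> subseq (block h i A ++ block h j A) A.
Proof.
move=> ltij; rewrite -[X in subseq _ X](cat_take_drop (j * h) A).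
apply: cat_subseq; last exact: take_subseq.
have -> : block h i A = block h i (take (j * h) A); last exact: block_subseq.
have le_ij : i * h + h <= j * h by rewrite addnC -mulSn leq_mul2r ltij orbT.
by rewrite /block !take_drop take_takel // addnC.
Qed.

Lemma total_oriented {T : eqType} (lt : rel (seq T)) W s t c :
  total_on_subseqs lt W -> subseq s W -> subseq t W -> s != t ->
  lt s t = c -> oriented lt c s t.
Proof.
move=> tot sW tW neq ltc; have := tot s t sW tW neq.
by rewrite /oriented ltc; case: c {ltc}.
Qed.

Lemma cat_neq {T : eqType} (L L' s s' : seq T) h :
  0 < h -> size L = h -> size L' = h -> uniq (L ++ L') -> L ++ s != L' ++ s'.
Proof.
move=> h_gt0 szL szL' uLL'; apply/eqP => /eqP.
rewrite eqseq_cat ?szL // => /andP[/eqP eqL _].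
move: szL uLL'; rewrite eqL => szL; rewrite cat_uniq.
case: L' {szL' eqL} szL => [h0|x L'] _.
  by rewrite -h0 in h_gt0.
case/and3P=> _ /hasPn/(_ x).
by rewrite !mem_head => /(_ isT).
Qed.

(** The four comparisons, between concatenations of two of the first blocks of
    [s], that decide whether lower or upper halves dominate. *)
Definition block_comparison {T : eqType} (lt : rel (seq T)) h i s :=
  let b j := block h j s in nth false
    [:: lt (b 0 ++ b 2) (b 1 ++ b 2); lt (b 0 ++ b 1) (b 0 ++ b 2);
        lt (b 0 ++ b 3) (b 1 ++ b 2); lt (b 0 ++ b 2) (b 1 ++ b 3)] i.

Definition block_comparison_sizes h := [:: 3 * h; 3 * h; 4 * h; 4 * h].

(** If raising the upper half of [L ++ R] moves it in direction [c 1], compare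
    this effect with that of raising the lower half, by means of [c 2] and
    [c 3].  When the lower half wins for halves in general position, it wins for
    arbitrary upper halves [R] and [R'] in [Z]: one passes from [R] to [R']
    through [P] or [Q], which lie entirely below and entirely above [Z], and
    changes the lower half in between.  The other case is symmetric.  The sets
    [P] and [Q] are the reason for the buffers around [Z]. *)
Lemma dominant_half {T : eqType} (lt : rel (seq T)) W h
    (c : nat -> bool) :
  0 < h -> uniq W -> transitive lt -> total_on_subseqs lt W ->
  (forall i, i < 4 ->
     homogeneous (block_comparison lt h i)
       (nth 0 (block_comparison_sizes h) i) W (c i)) ->
  exists e,
    (forall A P Z Q L L' R R', subseq (A ++ P ++ Z ++ Q) W ->
      subseq (L ++ L') A -> subseq R Z -> subseq R' Z ->
      size P = h -> size Q = h ->
      size L = h -> size L' = h -> size R = h -> size R' = h ->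
      oriented lt e (L ++ R) (L' ++ R')) \/
    (forall A P Z Q L L' R R', subseq (P ++ Z ++ Q ++ A) W ->
      subseq (R ++ R') A -> subseq L Z -> subseq L' Z ->
      size P = h -> size Q = h ->
      size L = h -> size L' = h -> size R = h -> size R' = h ->
      oriented lt e (L ++ R) (L' ++ R')).
Proof.
move=> h_gt0 uW tr tot hom.
have uniqW s : subseq s W -> uniq s by move/subseq_uniq; apply.
have H1 L L' R : subseq (L ++ L' ++ R) W -> size L = h -> size L' = h ->
    size R = h -> oriented lt (c 0) (L ++ R) (L' ++ R).
  move=> sub sL sL' sR; apply: total_oriented tot _ _ _ _.
  - by apply: subseq_trans sub; rewrite subseq_cat2l suffix_subseq.
  - by apply: subseq_trans sub; rewrite suffix_subseq.
  - apply: cat_neq h_gt0 _ _ _ => //; apply: uniqW; apply: subseq_trans sub.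
    by rewrite catA prefix_subseq.
  - rewrite -(hom 0 isT _ sub) /=; last by rewrite !size_cat; lia.
    by rewrite /block_comparison /= !(blockS, block0, blockL).
have H2 L R R' : subseq (L ++ R ++ R') W -> size L = h -> size R = h ->
    size R' = h -> oriented lt (c 1) (L ++ R) (L ++ R').
  move=> sub sL sR sR'; apply: total_oriented tot _ _ _ _.
  - by apply: subseq_trans sub; rewrite subseq_cat2l prefix_subseq.
  - by apply: subseq_trans sub; rewrite subseq_cat2l suffix_subseq.
  - rewrite eqseq_cat // eqxx /= -[R]cats0 -[R']cats0.
    apply: cat_neq h_gt0 _ _ _ => //; apply: uniqW; apply: subseq_trans sub.
    by rewrite suffix_subseq.
  - rewrite -(hom 1 isT _ sub) /=; last by rewrite !size_cat; lia.
    by rewrite /block_comparison /= !(blockS, block0, blockL).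
have H34 L L' R R' : subseq (L ++ L' ++ R ++ R') W -> size L = h ->
    size L' = h -> size R = h -> size R' = h ->
    oriented lt (c 2) (L ++ R') (L' ++ R) /\
    oriented lt (c 3) (L ++ R) (L' ++ R').
  move=> sub sL sL' sR sR'.
  have uLL' : uniq (L ++ L').
    by apply: uniqW; apply: subseq_trans sub; rewrite catA prefix_subseq.
  have sz : size (L ++ L' ++ R ++ R') = 4 * h by rewrite !size_cat; lia.
  have sLR : subseq (L ++ R) W.
    apply: subseq_trans sub; rewrite subseq_cat2l.
    by apply: subseq_trans (suffix_subseq _ _); apply: prefix_subseq.
  have sLR' : subseq (L ++ R') W.
    apply: subseq_trans sub; rewrite subseq_cat2l.
    by apply: subseq_trans (suffix_subseq _ _); apply: suffix_subseq.
  have sL'R : subseq (L' ++ R) W.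
    apply: subseq_trans sub; apply: subseq_trans (suffix_subseq _ _).
    by rewrite subseq_cat2l prefix_subseq.
  have sL'R' : subseq (L' ++ R') W.
    apply: subseq_trans sub; apply: subseq_trans (suffix_subseq _ _).
    by rewrite subseq_cat2l suffix_subseq.
  split; apply: total_oriented tot _ _ _ _ => //; try exact: cat_neq h_gt0 _ _ _.
  - rewrite -(hom 2 isT _ sub) //.
    by rewrite /block_comparison /= !(blockS, block0, blockL).
  - rewrite -(hom 3 isT _ sub) //.
    by rewrite /block_comparison /= !(blockS, block0, blockL).
have otr e := oriented_trans _ e tr.
have Hflip e x y : oriented lt (~~ e) x y = oriented lt e y x by case: e.
case: (boolP ((c 2 == c 1) || (c 3 != c 1))) => [lead|].
  (* The lower half dominates. *)
  exists (if c 2 == c 1 then c 1 else ~~ c 1); left.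
  move=> A P Z Q L L' R R' sub sLL' sR sR' szP szQ szL szL' szR szR'.
  have sL : subseq L A by apply: subseq_trans sLL'; apply: prefix_subseq.
  have sL' : subseq L' A by apply: subseq_trans sLL'; apply: suffix_subseq.
  have sPR X Y : subseq X A -> subseq Y Z -> subseq (X ++ P ++ Y) W.
    move=> sX sY; apply: subseq_trans sub; apply: cat_subseq => //.
    by rewrite subseq_cat2l; apply: subseq_trans sY _; apply: prefix_subseq.
  have sRQ X Y : subseq X A -> subseq Y Z -> subseq (X ++ Y ++ Q) W.
    move=> sX sY; apply: subseq_trans sub; apply: cat_subseq => //.
    by apply: subseq_trans (suffix_subseq _ _); apply: cat_subseq.
  have sPQ : subseq (L ++ L' ++ P ++ Q) W.
    apply: subseq_trans sub; rewrite catA; apply: cat_subseq => //.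
    by rewrite subseq_cat2l suffix_subseq.
  have [H3 H4] := H34 _ _ _ _ sPQ szL szL' szP szQ.
  have [eq21|neq21] := eqVneq (c 2) (c 1).
    rewrite eq21 in H3.
    (* L ++ R, then L ++ Q, then L' ++ P, then L' ++ R' *)
    apply: (otr) (H2 _ _ _ (sRQ _ _ sL sR) szL szR szQ) _.
    exact: (otr) H3 (H2 _ _ _ (sPR _ _ sL' sR') szL' szP szR').
  (* L ++ R, then L ++ P, then L' ++ Q, then L' ++ R' *)
  rewrite (negPf neq21) /= in lead.
  rewrite (_ : c 3 = ~~ c 1) in H4; last by case: (c 3) (c 1) lead => -[].
  have {}H2 X Y Y' : subseq (X ++ Y ++ Y') W -> size X = h -> size Y = h ->
      size Y' = h -> oriented lt (~~ c 1) (X ++ Y') (X ++ Y).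
    by rewrite Hflip; apply: H2.
  apply: (otr) (H2 _ _ _ (sPR _ _ sL sR) szL szP szR) _.
  exact: (otr) H4 (H2 _ _ _ (sRQ _ _ sL' sR') szL' szR' szQ).
rewrite negb_or negbK => /andP[neq21 /eqP eq31].
(* The upper half dominates. *)
exists (c 1); right.
move=> A P Z Q L L' R R' sub sRR' sL sL' szP szQ szL szL' szR szR'.
have sR : subseq R A by apply: subseq_trans sRR'; apply: prefix_subseq.
have sR' : subseq R' A by apply: subseq_trans sRR'; apply: suffix_subseq.
have sPL X Y : subseq X Z -> subseq Y A -> subseq (P ++ X ++ Y) W.
  move=> sX sY; apply: subseq_trans sub; rewrite subseq_cat2l.
  by apply: cat_subseq => //; apply: subseq_trans sY _; apply: suffix_subseq.
have sLQ X Y : subseq X Z -> subseq Y A -> subseq (X ++ Q ++ Y) W.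
  move=> sX sY; apply: subseq_trans sub; apply: subseq_trans (suffix_subseq _ _).
  by apply: cat_subseq => //; rewrite subseq_cat2l.
have sPQ : subseq (P ++ Q ++ R ++ R') W.
  apply: subseq_trans sub; rewrite subseq_cat2l.
  by apply: subseq_trans (suffix_subseq _ _); rewrite subseq_cat2l.
have [H3 H4] := H34 _ _ _ _ sPQ szP szQ szR szR'.
have [eq01|neq01] := eqVneq (c 0) (c 1); last first.
  have {}H1 X X' Y : subseq (X ++ X' ++ Y) W -> size X = h -> size X' = h ->
      size Y = h -> oriented lt (c 1) (X' ++ Y) (X ++ Y).
    rewrite -Hflip (_ : ~~ c 1 = c 0); first exact: H1.
    by case: (c 0) (c 1) neq01 => -[].
  rewrite eq31 in H4.
  (* L ++ R, then P ++ R, then Q ++ R', then L' ++ R' *)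
  apply: (otr) (H1 _ _ _ (sPL _ _ sL sR) szP szL szR) _.
  exact: (otr) H4 (H1 _ _ _ (sLQ _ _ sL' sR') szL' szQ szR').
rewrite eq01 in H1.
(* L ++ R, then Q ++ R, then P ++ R', then L' ++ R' *)
apply: (otr) (H1 _ _ _ (sLQ _ _ sL sR) szL szQ szR) _.
apply: (otr) _ (H1 _ _ _ (sPL _ _ sL' sR') szP szL' szR').
by rewrite -Hflip (_ : ~~ c 1 = c 2) //; case: (c 2) (c 1) neq21 => -[].
Qed.


(** * Levels of sets whose order is governed by their controls *)

Lemma size_cat_split {T : Type} (s : seq T) a b :
  size s = a + b -> exists s1 s2, [/\ s = s1 ++ s2, size s1 = a & size s2 = b].
Proof.
move=> sz; exists (take a s), (drop a s); rewrite cat_take_drop.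
by rewrite size_takel ?size_drop sz ?leq_addr // addKn.
Qed.

(** [S a O] adds the control numbered [a] to the content [O]. *)
Definition controlled {T : eqType} (lt : rel (seq T)) h M W Z
    (S : nat -> seq T -> seq T) : Prop :=
  (forall a O, a < M -> subseq O Z -> size O = h ->
     [/\ subseq (S a O) W, {subset O <= S a O} & size (S a O) = h + h]) /\
  (forall a b O O', a < b -> b < M -> subseq O Z -> subseq O' Z ->
     size O = h -> size O' = h -> lt (S a O) (S b O')).

Lemma controlled_oriented {T : eqType} (lt : rel (seq T)) e h M W Z S :
  controlled (oriented lt e) h M W Z S ->
  exists S', controlled lt h M W Z S'.
Proof.
case: e => -[fit ord]; first by exists S.
exists (fun a => S (M.-1 - a)); split.
  by move=> a O lta; apply: fit; lia.
by move=> a b O O' ltab ltb sO sO' szO szO'; apply: ord => //; lia.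
Qed.

(** The controls are consecutive blocks [A] of a homogeneous sequence, on the side
    of the dominant half, and the zone [Z] is what remains after removing the
    buffers [P] and [Q] that [dominant_half] requires around it. *)
Lemma controlled_exists h M n : 0 < h -> exists N,
  forall (T : eqType) (W : seq T) (lt : rel (seq T)),
    uniq W -> transitive lt -> total_on_subseqs lt W -> N <= size W ->
  exists Z S, [/\ subseq Z W, size Z = n & controlled lt h M W Z S].
Proof.
move=> h_gt0.
have [N ram] := ramsey_many (block_comparison_sizes h)
  (M * h + (h + (n + h))).
exists N => T W lt uW tr tot leW.
have [W' [c [subW szW' hom]]] := ram T W (block_comparison lt h) leW.
have uW' : uniq W' by apply: subseq_uniq uW.
have tot' : total_on_subseqs lt W'.
  move=> s t sW tW.
  by apply: tot; [apply: subseq_trans sW _ | apply: subseq_trans tW _].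
suff [Z [S [e [sZ szZ ctl]]]] : exists Z S e,
    [/\ subseq Z W', size Z = n & controlled (oriented lt e) h M W' Z S].
  have [S' [fit ord]] := controlled_oriented _ _ _ _ _ _ _ ctl.
  exists Z, S'; split=> //; first exact: subseq_trans sZ subW.
  split=> // a O lta sO szO; have [sS OS szS] := fit a O lta sO szO.
  by split=> //; apply: subseq_trans sS subW.
have [e [left|right]] := dominant_half lt W' h c h_gt0 uW' tr tot' hom.
- have [A [s [eqW szA /size_cat_split[P [s' [eqs szP]]]]]] := size_cat_split _ _ _ szW'.
  move=> /size_cat_split[Z [Q [eqs' szZ szQ]]].
  rewrite {}eqs {}eqs' in eqW; rewrite {}eqW in left *.
  exists Z, (fun a O => block h a A ++ O), e; split=> //.
    apply: subseq_trans (suffix_subseq A _).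
    by apply: subseq_trans (suffix_subseq P _); apply: prefix_subseq.
  split=> [a O lta sO szO|a b O O' ltab ltb sO sO' szO szO'].
    split; last by rewrite size_cat szO (size_block _ _ _ _ szA).
      apply: cat_subseq (block_subseq _ _ _) _.
      apply: subseq_trans (suffix_subseq P _).
      by apply: subseq_trans sO _; apply: prefix_subseq.
    by move=> x xO; rewrite mem_cat xO orbT.
  apply: (left A P Z Q) => //; first exact: block_cat_subseq.
    by apply: size_block szA (ltn_trans ltab ltb).
  exact: size_block szA ltb.
- have szW2 : size W' = h + (n + (h + M * h)) by rewrite szW'; lia.
  have [P [s [eqW szP /size_cat_split[Z [s' [eqs szZ]]]]]] := size_cat_split _ _ _ szW2.
  move=> /size_cat_split[Q [A [eqs' szQ szA]]].
  rewrite {}eqs {}eqs' in eqW; rewrite {}eqW in right *.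
  exists Z, (fun a O => O ++ block h a A), e; split=> //.
    by apply: subseq_trans (suffix_subseq P _); apply: prefix_subseq.
  split=> [a O lta sO szO|a b O O' ltab ltb sO sO' szO szO'].
    split; last by rewrite size_cat szO (size_block _ _ _ _ szA).
      apply: subseq_trans (suffix_subseq P _); apply: cat_subseq => //.
      apply: subseq_trans (suffix_subseq Q _); exact: block_subseq.
    by move=> x xO; rewrite mem_cat xO.
  apply: (right A P Z Q) => //; first exact: block_cat_subseq.
    by apply: size_block szA (ltn_trans ltab ltb).
  exact: size_block szA ltb.
Qed.

(** Level [i] takes its contents from [Z i], and its sets lie in the larger zone
    [Z i.+1], hence are available as contents of the higher levels. *)
Definition tower {T : eqType} (lt : rel (seq T)) (h : nat -> nat) M k
    (Z : nat -> seq T) (S : nat -> nat -> seq T -> seq T) : Prop :=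
  forall i, i < k -> [/\ subseq (Z i) (Z i.+1), h i <= size (Z i)
    & controlled lt (h i) M (Z i.+1) (Z i) (S i)].

Lemma tower_mono {T : eqType} (lt : rel (seq T)) h M k Z S i j :
  tower lt h M k Z S -> i <= j -> j <= k -> subseq (Z i) (Z j).
Proof.
move=> tow leij; rewrite -(subnKC leij); elim: (j - i) => [|d IH].
  by rewrite addn0.
rewrite addnS => ltk; apply: subseq_trans (IH (ltnW ltk)) _.
by have [] := tow _ ltk.
Qed.

(** The top level is built first, and the lower ones inside its zone. *)
Lemma tower_exists (h : nat -> nat) M k : (forall i, 0 < h i) -> exists N,
  forall (T : eqType) (W : seq T) (lt : rel (seq T)),
    uniq W -> transitive lt -> total_on_subseqs lt W -> N <= size W ->
  exists Z S, Z k = W /\ tower lt h M k Z S.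
Proof.
move=> h_gt0; elim: k => [|k [N0 IH]].
  by exists 0 => T W lt *; exists (fun=> W), (fun _ _ => id).
have [N ctl] := controlled_exists (h k) M (maxn N0 (h k)) (h_gt0 k).
exists N => T W lt uW tr tot leW.
have [Zk [Sk [sZk szZk ctlk]]] := ctl T W lt uW tr tot leW.
have [||||Z [S [eqZ tow]]] := IH T Zk lt => //.
- exact: subseq_uniq uW.
- by move=> s t ss st; apply: tot; apply: subseq_trans sZk.
- by rewrite szZk leq_maxl.
exists (fun i => if i <= k then Z i else W), (fun i => if i < k then S i else Sk).
rewrite ltnn; split=> // i; rewrite ltnS leq_eqVlt => /predU1P[->|ltik].
  by rewrite /= eqxx ltnn eqZ szZk leq_maxr.
by rewrite /= ltik orbT; apply: tow.
Qed.

(** Read [r a i] as the [a]-th entry of the [i]-th of several increasing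
    sequences.  Taking for [s'] at each step the sequence whose current entry is
    least, the part of the [p]-th sequence before [p0 + p] lies below the part of
    every later one after it. *)
Lemma greedy_order {I : eqType} {T : Type} (le : rel T)
    (r : nat -> I -> T) (s : seq I) :
  total le -> transitive le -> uniq s -> forall p0,
  exists s' : seq I, perm_eq s' s /\
    forall i0 p q, p < q -> q < size s' ->
      le (r (p0 + p) (nth i0 s' p)) (r (p0 + p) (nth i0 s' q)).
Proof.
move=> tot tr; have [n] := ubnP (size s); elim: n s => // n IH s.
case: s => [|x s] ltn us p0; first by exists [::].
pose leI i j := le (r p0 i) (r p0 j).
have [y ys miny] : exists2 y, y \in x :: s & forall j, j \in x :: s -> leI y j.
  elim: (s) => [|z s' [y ys miny]] /=.
    exists x; first exact: mem_head.
    by move=> j; rewrite inE => /eqP ->; case/orP: (tot (r p0 x) (r p0 x)).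
  have [leyz|] := boolP (leI y z).
    exists y; first by move: ys; rewrite !inE orbCA => ->; rewrite orbT.
    by move=> j; rewrite !inE orbCA => /predU1P[->//|jxs]; apply: miny; rewrite inE.
  move=> nle; have lezy : leI z y.
    by move: (tot (r p0 z) (r p0 y)); rewrite [X in _ || X](negPf nle) orbF.
  exists z; first by rewrite !inE eqxx orbT.
  move=> j; rewrite !inE orbCA => /predU1P[->|jxs].
    by case/orP: (tot (r p0 z) (r p0 z)).
  by apply: tr lezy (miny j _); rewrite inE.
have [|s' [perm ord]] := IH (rem y (x :: s)) _ (rem_uniq _ us) p0.+1.
  by rewrite size_rem.
exists (y :: s'); split.
  by rewrite perm_sym (perm_trans (perm_to_rem ys)) // perm_cons perm_sym.
move=> i0 [|p] [|q] //= ltpq ltq; rewrite ?addn0 ?addnS -?addSn.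
  apply: miny; apply: (mem_rem (x := y)); rewrite -(perm_mem perm).
  exact: mem_nth.
exact: ord.
Qed.

(** * Embedding a graph of bounded degree into a tower *)

Lemma pad_subseq {T : eqType} (Z U : seq T) h :
  uniq Z -> {subset U <= Z} -> size U <= h -> h <= size Z ->
  exists O, [/\ subseq O Z, size O = h & {subset U <= O}].
Proof.
move=> uZ sUZ leU leZ.
pose X := undup U ++ [seq z <- Z | z \notin U].
have uX : uniq X.
  rewrite cat_uniq undup_uniq filter_uniq // andbT /=.
  by apply/hasPn => z; rewrite mem_filter mem_undup => /andP[].
have memX : X =i Z.
  move=> z; rewrite mem_cat mem_undup mem_filter.
  by case: (boolP (z \in U)) => // /sUZ ->.
have szX : size X = size Z by apply/perm_size; rewrite uniq_perm.
exists [seq z <- Z | z \in take h X]; split; first exact: filter_subseq.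
  rewrite -[RHS](size_takel (n0 := h) (s := X)) ?szX //.
  apply/perm_size/uniq_perm; rewrite ?filter_uniq ?take_uniq // => z.
  rewrite mem_filter; case: (boolP (z \in take h X)) => //= /mem_take.
  by rewrite memX.
move=> z zU; rewrite mem_filter sUZ // andbT take_cat.
have leUh : size (undup U) <= h := leq_trans (size_undup U) leU.
by rewrite ltnNge leUh /= mem_cat mem_undup zU.
Qed.

(** The content of [v] contains the images of its at most [Delta] neighbours on
    lower levels, all of size at most that of the level just below; the growth
    condition on [h] leaves room for them, and [pad_subseq] fills the rest. *)
Lemma tower_embedding {T : eqType} (lt : rel (seq T)) h M k Z S
    (V : finType) (e : rel V) (Delta : nat) (lev ind : V -> nat) :
  uniq (Z k) -> tower lt h M k Z S ->
  (forall i j, i < j -> Delta * (h i + h i) <= h j) ->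
  (forall v, #|[set u | e v u]| <= Delta) ->
  (forall v, lev v < k) -> (forall v, ind v < M) ->
  exists F O : V -> seq T, forall v,
    [/\ subseq (O v) (Z (lev v)), size (O v) = h (lev v),
        F v = S (lev v) (ind v) (O v)
      & forall u, e v u -> lev u < lev v -> {subset F u <= O v}].
Proof.
move=> uZk tow hgrow degV levk indM.
have Zmono i j : i <= j -> j <= k -> subseq (Z i) (Z j) by apply: tower_mono tow.
suff [F [O FO]] : exists F O : V -> seq T, forall v, lev v < k ->
    [/\ subseq (O v) (Z (lev v)), size (O v) = h (lev v),
        F v = S (lev v) (ind v) (O v)
      & forall u, e v u -> lev u < lev v -> {subset F u <= O v}].
  by exists F, O => v; apply: FO.
elim: {-2}k (leqnn k) => [|i IH] ltik; first by exists (fun=> [::]), (fun=> [::]).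
have [F [O FO]] := IH (ltnW ltik).
have pad v : exists O', lev v = i ->
    [/\ subseq O' (Z i), size O' = h i
      & forall u, e v u -> lev u < i -> {subset F u <= O'}].
  have [_|/eqP neq] := eqVneq (lev v) i; last by exists [::].
  pose U := flatten [seq F u | u <- enum [set u | e v u] & lev u < i].
  have [_ leZ _] := tow i ltik.
  have fitF u : lev u < i -> subseq (F u) (Z i) /\ size (F u) = h (lev u) + h (lev u).
    move=> ltu; have [sO szO -> _] := FO u ltu.
    have ltuk := ltn_trans ltu ltik.
    have [_ _ [fit _]] := tow _ ltuk.
    have [sS _ ->] := fit _ _ (indM u) sO szO; split=> //.
    by apply: subseq_trans sS (Zmono _ _ ltu (ltnW ltik)).
  have sUZ : {subset U <= Z i}.
    move=> x /flattenP[_ /mapP[u + ->]] xu; rewrite mem_filter => /andP[ltu _].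
    by apply: mem_subseq xu; case: (fitF u ltu).
  have szU : size U <= h i.
    have le_all u : u \in [seq u <- enum [set u | e v u] | lev u < i] ->
        Delta * size (F u) <= h i.
      rewrite mem_filter => /andP[ltu _].
      by have [_ ->] := fitF u ltu; apply: hgrow.
    have szs : size [seq u <- enum [set u | e v u] | lev u < i] <= Delta.
      apply: leq_trans (degV v); rewrite cardE size_filter; exact: count_size.
    rewrite /U; move: le_all szs; set s := [seq u <- _ | _] => le_all szs.
    have [Delta0|Delta_gt0] := posnP Delta.
      by move: szs; rewrite Delta0 leqn0 => /nilP ->.
    rewrite -(leq_pmul2l Delta_gt0).
    apply: leq_trans (leq_mul szs (leqnn (h i))).
    elim: s {szs} le_all => [|u s IHs] le_all; first by rewrite muln0.
    rewrite /= size_cat mulnDr mulSn leq_add ?le_all ?mem_head // IHs // => w ws.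
    by rewrite le_all // inE ws orbT.
  have uZi : uniq (Z i) by apply: subseq_uniq uZk; apply: Zmono => //; apply: ltnW.
  have [O' [sO' szO' UO']] := pad_subseq _ _ _ uZi sUZ szU leZ.
  exists O' => _; split=> // u evu ltu x xu; apply: UO'.
  apply/flattenP; exists (F u) => //; apply: map_f.
  by rewrite mem_filter ltu mem_enum inE.
have [O' padO] := fin_all_exists pad.
exists (fun v => if lev v == i then S i (ind v) (O' v) else F v).
exists (fun v => if lev v == i then O' v else O v) => v.
have noti u j : lev u < j -> j <= i -> (lev u == i) = false by lia.
rewrite ltnS leq_eqVlt => /predU1P[eqv|ltv].
  have [sO' szO' FO'] := padO v eqv.
  by rewrite eqv eqxx; split=> // u evu ltu; rewrite (noti _ _ ltu) //; apply: FO'.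
have [sO szO eqF inF] := FO v ltv.
rewrite (noti _ _ ltv) //; split=> // u evu ltu.
by rewrite (noti _ _ ltu (ltnW ltv)); apply: inF.
Qed.

(** * The graph of bounded subsets *)

Definition subset_adj (T : finType) m : rel {set T} := fun A B =>
  (A \proper B) && (#|B| <= m) || (B \proper A) && (#|A| <= m).

Lemma subset_adj_sym T m : symmetric (subset_adj T m).
Proof. by move=> A B; rewrite /subset_adj orbC. Qed.

Lemma subset_adj_irr T m : irreflexive (subset_adj T m).
Proof. by move=> A; rewrite /subset_adj properxx. Qed.

Definition subset_graph (T : finType) m : sgraph :=
  SGraph (subset_adj_sym T m) (subset_adj_irr T m).

Lemma subset_graph_degenerate T m : degenerate (2 ^ m) (subset_graph T m).
Proof.
move=> S f [_ fS] /set0Pn[A0 A0S].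
have [A AS maxA] := arg_maxnP (fun A : {set T} => #|A|) A0S.
exists A => //; have [leA|ltA] := leqP #|A| m; last first.
  rewrite (_ : [set B | f A B] = set0) ?cards0 //.
  apply/setP => B; rewrite !inE; apply/negP => /fS[_ BS].
  rewrite /= /subset_adj (leqNgt #|A|) ltA andbF orbF => /andP[/proper_card ltAB _].
  by move: ltAB; rewrite ltnNge => /negP; apply; apply: maxA.
apply: leq_trans (leq_pexp2l _ leA) => //; rewrite -card_powerset.
apply/subset_leq_card/subsetP => B; rewrite !inE => /fS[_ BS].
case/orP=> /andP[prop _]; last exact: proper_sub.
by have := proper_card prop; rewrite ltnNge; have /= -> := maxA B BS.
Qed.

(** * Ordered graphs *)

Lemma rank_exists (H : ordered_graph) : exists rank : H -> nat,
  (forall x, rank x < #|H|) /\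
  (forall x y, ole x y -> x != y -> rank x < rank y).
Proof.
have [refl anti tr tot] := ole_linear H.
exists (fun x => #|[set y | ole y x && (y != x)]|); split=> [x|x y lexy neq].
  rewrite -cardsT; apply/proper_card/properP; split; first exact: subsetT.
  by exists x; rewrite ?inE // eqxx andbF.
apply/proper_card/properP; split.
  apply/subsetP => z; rewrite !inE => /andP[lezx nzx].
  rewrite (tr _ _ _ lezx lexy); apply: contraNneq neq => eqzy.
  by apply/eqP/anti; rewrite lexy -eqzy.
by exists x; rewrite !inE ?lexy // eqxx andbF.
Qed.

(** The position of [x] is the number of blocks lying entirely before the block of
    [x]; by convexity these are the blocks avoiding [x] that have some element
    below [x]. *)
Lemma position_exists (H : ordered_graph) k :
  interval_chromatic_number H <= k -> exists pos : H -> nat,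
  [/\ forall x, pos x < k, forall x y, ole x y -> pos x <= pos y
    & forall x y, adj x y -> pos x != pos y].
Proof.
have [refl anti tr tot] := ole_linear H.
rewrite /interval_chromatic_number; case: ex_minnP => c.
case/existsP=> P /andP[/andP[partP /forall_inP colP] /eqP <-] _ leP.
have convex B x y z : B \in P -> x \in B -> z \in B -> ole x y -> ole y z -> y \in B.
  case/colP/andP=> + _ => /forall_inP intB xB zB lexy leyz.
  by have /forall_inP/(_ z zB)/forallP/(_ y)/implyP := intB x xB; apply; rewrite lexy.
have indep B x y : B \in P -> x \in B -> y \in B -> ~~ adj x y.
  case/colP/andP=> _ /forall_inP indB xB yB.
  by have /forall_inP/(_ y yB) := indB x xB.
have blockof x : exists2 B, B \in P & x \in B.
  by have := in_setT x; rewrite -(cover_partition partP) => /bigcupP[B]; exists B.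
pose before x := [set B in P | (x \notin B) && [exists y in B, ole y x]].
have before_mono x y : ole x y -> before x \subset before y.
  move=> lexy; apply/subsetP => B; rewrite !inE.
  case/and3P=> BP xB /exists_inP[z zB lezx]; rewrite BP /=; apply/andP; split.
    by apply: contra xB => yB; apply: (convex B z x y).
  by apply/exists_inP; exists z => //; apply: tr lexy.
have posadj x y : adj x y -> ole x y -> #|before x| < #|before y|.
  move=> axy lexy; apply/proper_card/properP; split; first exact: before_mono.
  have [B BP xB] := blockof x; exists B; rewrite !inE ?xB ?andbF // BP /=.
  apply/andP; split; last by apply/exists_inP; exists x.
  by apply/negP => yB; have := indep B x y BP xB yB; rewrite axy.
exists (fun x => #|before x|); split=> [x|x y lexy|x y axy].
- apply: leq_trans leP; apply/proper_card/properP; split.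
    by apply/subsetP => B; rewrite inE => /andP[].
  by have [B BP xB] := blockof x; exists B; rewrite ?inE ?xB ?andbF.
- exact/subset_leq_card/before_mono.
- case/orP: (tot x y) => lexy; first by rewrite neq_ltn posadj.
  by rewrite neq_ltn (posadj y x) ?orbT // adj_sym.
Qed.

Lemma contains_copy_of_embedding (G H : ordered_graph) (phi : H -> G) :
  (forall x y, ole x y -> x != y -> ~~ ole (phi y) (phi x)) ->
  (forall x y, adj x y -> adj (phi x) (phi y)) ->
  contains_copy G H.
Proof.
move=> mono hom.
have [reflH antiH _ totH] := ole_linear H.
have [reflG antiG _ totG] := ole_linear G.
have inj : injective phi.
  move=> x y eqxy; apply/eqP; apply: contraT => neq.
  have [lexy|leyx] := orP (totH x y).
    by have := mono x y lexy neq; rewrite eqxy reflG.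
  by have := mono y x leyx; rewrite eq_sym eqxy reflG => /(_ neq).
exists (phi @: [set: H]).
exists (fun a b => [exists x, exists y, [&& a == phi x, b == phi y & adj x y]]).
split; first split.
- move=> a b; apply/existsP/existsP => -[x /existsP[y /and3P[ax by_ axy]]];
    by exists y; apply/existsP; exists x; rewrite by_ ax adj_sym.
- move=> a b /existsP[x /existsP[y /and3P[/eqP-> /eqP-> axy]]].
  by split; [apply: imset_f | apply: imset_f | apply: hom].
exists phi; split=> //.
  move=> x y; apply/existsP/idP => [[x' /existsP[y']]|axy].
    by rewrite !(inj_eq inj) => /and3P[/eqP-> /eqP->].
  by exists x; apply/existsP; exists y; rewrite !eqxx.
move=> x y; have [->|neq] := eqVneq x y; first by rewrite reflG reflH.
have [lexy|leyx] := orP (totH x y).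
  have := mono x y lexy neq; have := totG (phi x) (phi y); rewrite lexy.
  by case: (ole (phi x) _) => //= ->.
rewrite (negPf (mono y x leyx _)) 1?eq_sym //.
by apply/esym/negP => lexy; case/eqP: neq; apply: antiH; rewrite lexy.
Qed.

(** * The theorem *)

Theorem theorem1p5 (Delta k : nat) (hDelta : 1 <= Delta) (hk : 1 <= k) :
  exists D : nat,
    forall H : ordered_graph,
      max_degree H <= Delta ->
      interval_chromatic_number H <= k ->
      exists G : sgraph,
        degenerate D G /\
        forall (le : rel G) (hle : linear_order le),
          contains_copy (OrderedGraph hle) H.
Proof.
pose h i := (2 * Delta) ^ i.
pose m := 2 * h k.
exists (2 ^ m) => H degH chiH.
have h_gt0 i : 0 < h i by rewrite expn_gt0 muln_gt0 hDelta.
have h_mono i j : i <= j -> h i <= h j by apply: leq_pexp2l; rewrite muln_gt0 hDelta.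
have h_grow i j : i < j -> Delta * (h i + h i) <= h j.
  move=> ltij; apply: leq_trans (h_mono _ _ ltij).
  by rewrite addnn -mul2n mulnCA mulnA -expnS.
have [rank [ltrank mono_rank]] := rank_exists H.
have [pos [ltpos mono_pos adj_pos]] := position_exists H k chiH.
(* Each range of controls has one more element than H, so that it can start with
   a control that no vertex uses and that only marks the end of the previous range. *)
pose w := #|H|.+1.
have [N tow] := tower_exists h (k * w).+1 k h_gt0.
exists (subset_graph 'I_N m); split; first exact: subset_graph_degenerate.
move=> le hle; have [refl anti tr tot] := hle.
pose toset (s : seq 'I_N) : {set 'I_N} := [set x in s].
pose leS s t := le (toset s) (toset t).
pose lt s t := ~~ leS t s.
have ltW s t : lt s t -> leS s t.
  by rewrite /lt /leS; case/orP: (tot (toset s) (toset t)) => ->.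
have le_lt_trans s t u : leS s t -> lt t u -> lt s u.
  by move=> lest; apply: contra => leus; apply: tr leus lest.
have lt_trans : transitive lt.
  by move=> t s u /ltW; apply: le_lt_trans.
pose W := enum 'I_N.
have uW : uniq W := enum_uniq _.
have totW : total_on_subseqs lt W.
  move=> s t sW tW; apply: contraR; rewrite negb_or !negbK => /andP[lets lest].
  have /setP eqst : toset s = toset t.
    by apply: anti; rewrite /leS in lets lest; rewrite lest lets.
  have /(subseq_uniqP uW) -> := sW; have /(subseq_uniqP uW) -> := tW.
  by apply/eqP/eq_filter => x; have := eqst x; rewrite !inE.
have [|Z [S [ZkW twr]]] := tow _ W lt uW lt_trans totW.
  by rewrite size_enum_ord.
have [s [perm_s order_s]] := greedy_order leS
  (fun p i => S i (p * w) (take (h i) (Z i))) (iota 0 k)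
  (fun x y => tot (toset x) (toset y)) (fun y x z => tr (toset y) _ _)
  (iota_uniq 0 k) 1.
have szs : size s = k by rewrite (perm_size perm_s) size_iota.
pose lev v := nth 0 s (pos v).
pose ind v := pos v * w + (rank v).+1.
have lt_lev v : lev v < k.
  have : lev v \in s by apply: mem_nth; rewrite szs.
  by rewrite (perm_mem perm_s) mem_iota.
have lev_inj u v : lev u = lev v -> pos u = pos v.
  move/eqP; rewrite nth_uniq ?szs // => [/eqP//|].
  by rewrite (perm_uniq perm_s) iota_uniq.
have ind_lt v : ind v < (pos v).+1 * w.
  by rewrite mulSn [w + _]addnC ltn_add2l ltnS.
have ind_gt v : pos v * w < ind v by rewrite /ind -[X in X < _]addn0 ltn_add2l.
have indM v : ind v < (k * w).+1.
  by apply: leq_trans (ind_lt v) _; rewrite leqW // leq_mul2r ltpos orbT.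
have degV (v : H) : #|[set u | adj v u]| <= Delta.
  by apply: leq_trans degH; exact: (@leq_bigmax H (@degree H) v).
have uZk : uniq (Z k) by rewrite ZkW.
have [F [O FO]] := tower_embedding lt h _ k Z S H (@adj H) Delta lev ind
  uZk twr h_grow degV lt_lev indM.
have fitF v : [/\ uniq (F v), {subset O v <= F v} & #|toset (F v)| = 2 * h (lev v)].
  have [sO szO -> _] := FO v; have [_ _ [fit _]] := twr _ (lt_lev v).
  have [sS OS szS] := fit _ _ (indM v) sO szO.
  have uS : uniq (S (lev v) (ind v) (O v)).
    have sZ := tower_mono _ _ _ _ _ _ _ _ twr (lt_lev v) (leqnn k).
    by apply: subseq_uniq (subseq_trans sS sZ) uZk.
  by split=> //; rewrite cardsE (card_uniqP uS) szS addnn mul2n.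
apply: (contains_copy_of_embedding (OrderedGraph hle) H (fun v => toset (F v))).
  move=> x y lexy neq; change (lt (F x) (F y)).
  have [sOx szOx eqFx _] := FO x; have [sOy szOy eqFy _] := FO y.
  have [_ lex [_ ordx]] := twr _ (lt_lev x); have [_ ley [_ ordy]] := twr _ (lt_lev y).
  have := mono_pos x y lexy; rewrite leq_eqVlt => /predU1P[eqp|ltp].
    have eql : lev x = lev y by rewrite /lev eqp.
    rewrite eqFx eqFy -eql; apply: ordx => //; rewrite ?eql //.
    by rewrite /ind eqp ltn_add2l ltnS mono_rank.
  (* The separating set is the one with the control that marks the end of the
     range of x, on the level of x and then on that of y. *)
  have ltpk : (pos x).+1 * w < (k * w).+1 by rewrite ltnS leq_mul2r ltpos orbT.
  apply: (lt_trans (S (lev x) ((pos x).+1 * w) (take (h (lev x)) (Z (lev x))))).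
    by rewrite eqFx; apply: ordx; rewrite ?take_subseq ?size_takel.
  have := order_s 0 (pos x) (pos y) ltp; rewrite szs ltpos => /(_ isT).
  rewrite add1n => /le_lt_trans; apply.
  rewrite eqFy; apply: ordy; rewrite ?take_subseq ?size_takel //.
  by apply: leq_ltn_trans (ind_gt y); rewrite leq_mul2r ltp orbT.
have sub_adj u v : adj v u -> lev u < lev v ->
    (toset (F u) \proper toset (F v)) && (#|toset (F v)| <= m).
  move=> avu ltl; have [_ _ _ inO] := FO v.
  have [_ _ cu] := fitF u; have [_ OF cv] := fitF v.
  rewrite cv leq_mul2l h_mono ?orbT ?andbT; last exact: ltnW.
  rewrite properEcard cu cv; apply/andP; split.
    by apply/subsetP => x; rewrite !inE => xF; apply: OF; apply: inO xF.
  rewrite ltn_mul2l /=; apply: leq_trans (h_grow _ _ ltl).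
  by apply: leq_trans (leq_pmull _ hDelta); rewrite addnn -mul2n ltn_Pmull.
move=> x y axy; rewrite /= /subset_adj.
have := adj_pos x y axy; have [ltl _|ltl _|/lev_inj-> //] := ltngtP (lev x) (lev y).
- by rewrite sub_adj // adj_sym.
- by rewrite (sub_adj y x) ?orbT.
- by rewrite eqxx.
Qed.
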